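(* Let $f,t,n$ be integers with $1\le t\le f$ and $n\ge 3f+2t-1$. Then there exists a Byzantine consensus protocol for $n$ processes in the partially synchronous authenticated message-passing model such that: (i) in every infinite execution with at most $f$ Byzantine processes, the protocol satisfies liveness, consistency and extended validity; and (ii) the protocol is fast in the presence of at most $t$ failures: there is a designated process $\ell$ (the leader of the first view) such that in every execution in which $\ell$ is correct, at most $t$ processes are Byzantine, and the network is synchronous from the beginning (GST $=0$), every correct process decides within two message delays (i.e. by time $2\Delta$). In particular (case $t=f$), $n\ge 5f-1$ processes suffice for a fast protocol tolerating $f$ Byzantine failures.
   Context: Model. There are $n$ processes $\Pi=\{p_1,\dots,p_n\}$, each assigned a deterministic algorithm. A process that deviates from its algorithm (arbitrary steps, or stopping prematurely) is Byzantine; the others are correct. Processes communicate over reliable, authenticated point-to-point channels (no loss, duplication, creation or modification between correct processes; the sender of a received message is identifiable). Each process has a public/private key pair, all public keys are known, and the (computationally bounded) adversary cannot forge digital signatures of correct processes. The system is partially synchronous: there is a known bound $\Delta$ and an unknown time GST (global stabilization time) after which every message sent by a correct process to a correct process is received within $\Delta$ time units. Processes have loosely synchronized clocks, and local computation time is neglected (taken to be zero). All processes start at time $0$. A view synchronization sub-protocol is assumed to be available: it maintains at each process a view number, initially $1$, that is never decreased at a correct process; each view $v$ has a leader $\mathrm{leader}(v)=p_{(v \bmod n)+1}$, and a leader is ''elected'' when all correct processes have the corresponding current view number; in any infinite execution a correct leader is elected infinitely often; and if a correct leader is elected after GST, no correct process changes its view number for at least $5\Delta$ time. Consensus. Each process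 $p$ has an input value $x^{\mathrm{in}}_p$, and each correct process may decide on a value at most once. Liveness: each correct process eventually decides on some value. Consistency: no two correct processes decide on different values. Extended validity: if all processes are correct, then only a value proposed by (i.e. the input of) some process can be decided on. *)

(* Defs.v *)
From mathcomp Require Import all_boot all_order all_algebra.
From mathcomp Require Import reals.

Set Implicit Arguments.
Unset Strict Implicit.
Unset Printing Implicit Defensive.

Import Order.TTheory GRing.Theory Num.Theory.
Local Open Scope ring_scope.

(* Processes are p_1, ..., p_n; p_(i+1) is represented by i : 'I_n.  V is the
   type of consensus values, R the type of points in time. *)

(* Messages are symbolic terms; Sign p c is the content c together with the
   signature of p on c (the content can be read off, and the signature can be
   verified, by everyone). *)
Inductive msg (n : nat) (V : Type) : Type :=
| Const of nat
| Val of V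
| Pair of msg n V & msg n V
| Sign of 'I_n & msg n V.

Fixpoint signature_in (n : nat) (V : Type) (p : 'I_n) (c m : msg n V) : Prop :=
  match m with
  | Pair a b => signature_in p c a \/ signature_in p c b
  | Sign q b => (q = p /\ b = c) \/ signature_in p c b
  | _ => False
  end.

(* Stimuli of a process.  Start is its first step; NewView v is the notification
   by the view synchronizer that the view number has been changed to v; Wake is
   a step taken without external stimulus. *)
Inductive event (n : nat) (V : Type) : Type :=
| Start
| Recv of 'I_n & msg n V
| NewView of nat
| Wake.

Inductive action (n : nat) (V : Type) : Type :=
| Send of 'I_n & msg n V
| Decide of V.

Arguments Start {n V}.
Arguments NewView {n V}.
Arguments Wake {n V}.
Arguments Decide {n V}.

(* The deterministic algorithm of each process p.  A step may depend on the
   reading of the local clock (the argument of type R). *)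
Record protocol (R : realType) (n : nat) (V : Type) := Protocol {
  pstate : Type;
  init : 'I_n -> V -> pstate;
  step : 'I_n -> R -> pstate -> event n V -> pstate * seq (action n V)
}.

Definition run (R : realType) (n : nat) (V : Type) (P : protocol R n V)
    (p : 'I_n) (x : V) (h : seq (R * event n V)) : pstate P :=
  foldl (fun s ce => (step p ce.1 s ce.2).1) (init P p x) h.

(* The algorithm of p has access to the private key of p only: in whatever
   circumstances it is run, a signature of another process can occur in its
   outgoing messages only if it occurred in a message received by p. *)
Definition respects_keys (R : realType) (n : nat) (V : Type)
    (P : protocol R n V) : Prop :=
  forall (p : 'I_n) (x : V) (h : seq (R * event n V)) (c : R) (e : event n V)
         (k : nat) (d : 'I_n) (m : msg n V) (q : 'I_n) (b : msg n V),
    onth (step p c (run P p x h) e).2 k = Some (Send d m) ->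
    signature_in q b m -> q <> p ->
    exists (j : nat) (q' : 'I_n) (m' : msg n V),
      onth (rcons (unzip2 h) e) j = Some (Recv q' m') /\ signature_in q b m'.

(* A trace interleaves the atomic steps of all the processes in an order
   compatible with causality: step i is taken by actor i at time i, is
   triggered by ev i, and results in the actions acts i.  If ev i is the
   reception of a message and source i = (j, k), then that message was sent by
   the k-th action of step j.  The reading of the clock of p at time tau is
   clock p tau. *)
Record trace (R : realType) (n : nat) (V : Type) := Trace {
  byz : {set 'I_n};
  input : 'I_n -> V;
  gst : R;
  clock : 'I_n -> R -> R;
  time : nat -> R;
  actor : nat -> 'I_n;
  ev : nat -> event n V;
  acts : nat -> seq (action n V);
  source : nat -> nat * nat
}.

Definition correct (R : realType) (n : nat) (V : Type) (E : trace R n V)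
  (p : 'I_n) : bool := p \notin byz E.

(* A configuration index i : nat refers to the configuration reached after the
   first i steps (steps 0, ..., i-1), at time config_time E i. *)
Definition config_time (R : realType) (n : nat) (V : Type) (E : trace R n V)
  (i : nat) : R := if i is j.+1 then time E j else 0.

Fixpoint state_at (R : realType) (n : nat) (V : Type) (P : protocol R n V)
    (E : trace R n V) (p : 'I_n) (i : nat) : pstate P :=
  if i is j.+1 then
    let s := state_at P E p j in
    if actor E j == p then (step p (clock E p (time E j)) s (ev E j)).1 else s
  else init P p (input E p).

Fixpoint view_at (R : realType) (n : nat) (V : Type) (E : trace R n V)
    (p : 'I_n) (i : nat) : nat :=
  if i is j.+1 then
    if ev E j is NewView v then
      if actor E j == p then v else view_at E p j
    else view_at E p j
  else 1%N.

Definition sends_at (R : realType) (n : nat) (V : Type) (E : trace R n V)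
    (i k : nat) (p q : 'I_n) (m : msg n V) : Prop :=
  actor E i = p /\ onth (acts E i) k = Some (Send q m).

Definition receives_at (R : realType) (n : nat) (V : Type) (E : trace R n V)
    (i : nat) (q p : 'I_n) (m : msg n V) : Prop :=
  actor E i = p /\ ev E i = Recv q m.

Definition decides_at (R : realType) (n : nat) (V : Type) (E : trace R n V)
    (i k : nat) (p : 'I_n) (x : V) : Prop :=
  actor E i = p /\ onth (acts E i) k = Some (Decide x).

(* Infinite executions: time passes beyond any bound. *)
Definition time_wf (R : realType) (n : nat) (V : Type) (E : trace R n V) :
    Prop :=
  [/\ forall i, 0 <= time E i,
      forall i, time E i <= time E i.+1 &
      forall T : R, exists i, T < time E i].

Definition clocks_wf (R : realType) (n : nat) (V : Type) (E : trace R n V) :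
    Prop :=
  (forall p, correct E p -> {homo clock E p : a b / a <= b}) /\
  exists eps : R, forall p q, correct E p -> correct E q ->
    forall tau : R, 0 <= tau -> `|clock E p tau - clock E q tau| <= eps.

Definition starts_at_0 (R : realType) (n : nat) (V : Type) (E : trace R n V) :
    Prop :=
  forall p, correct E p ->
    exists i, [/\ actor E i = p, ev E i = Start, time E i = 0 &
      forall j, actor E j = p -> (i <= j)%N /\ (ev E j = Start -> j = i)].

Definition keeps_running (R : realType) (n : nat) (V : Type)
    (E : trace R n V) : Prop :=
  forall p, correct E p ->
    forall T : R, exists i, [/\ actor E i = p, ev E i = Wake & T <= time E i].

Definition follows (R : realType) (n : nat) (V : Type) (P : protocol R n V)
    (E : trace R n V) : Prop :=
  forall i, correct E (actor E i) ->
    acts E i = (step (actor E i) (clock E (actor E i) (time E i))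
                     (state_at P E (actor E i) i) (ev E i)).2.

(* The actions of Byzantine processes are arbitrary, except that a signature of
   a correct process q must have been issued by q before: it occurs in some
   message that q sent earlier (to anybody). *)
Definition unforgeable (R : realType) (n : nat) (V : Type) (E : trace R n V) :
    Prop :=
  forall i k p d m q b,
    ~~ correct E p -> sends_at E i k p d m ->
    correct E q -> signature_in q b m ->
    exists j k' d' m',
      [/\ (j < i)%N, sends_at E j k' q d' m' & signature_in q b m'].

Definition authenticated (R : realType) (n : nat) (V : Type)
    (E : trace R n V) : Prop :=
  forall i p q m, correct E p -> receives_at E i q p m ->
    ((source E i).1 < i)%N /\ sends_at E (source E i).1 (source E i).2 q p m.

Definition no_duplication (R : realType) (n : nat) (V : Type)
    (E : trace R n V) : Prop :=
  forall i i' p q q' m m', correct E p ->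
    receives_at E i q p m -> receives_at E i' q' p m' ->
    source E i = source E i' -> i = i'.

Definition no_loss (R : realType) (n : nat) (V : Type) (E : trace R n V) :
    Prop :=
  forall i k p q m, correct E p -> correct E q -> sends_at E i k p q m ->
    exists j, receives_at E j p q m /\ source E j = (i, k).

(* Messages sent before the global stabilization time are only guaranteed to be
   received eventually. *)
Definition partially_synchronous (R : realType) (n : nat) (V : Type)
    (Delta : R) (E : trace R n V) : Prop :=
  0 <= gst E /\
  forall i k p q m, correct E p -> correct E q -> sends_at E i k p q m ->
    gst E <= time E i ->
    exists j, [/\ receives_at E j p q m, source E j = (i, k) &
      time E j <= time E i + Delta].

(* leader(v) = p_((v mod n) + 1) *)
Definition leader (n : nat) (v : nat) (p : 'I_n) : bool :=
  nat_of_ord p == (v %% n)%N.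

Definition all_in_view (R : realType) (n : nat) (V : Type) (E : trace R n V)
    (i v : nat) : Prop :=
  forall p, correct E p -> view_at E p i = v.

(* The election of the leader of view v is the event of all the correct
   processes coming to have v as their current view number. *)
Definition elected_at (R : realType) (n : nat) (V : Type) (E : trace R n V)
    (i v : nat) (l : 'I_n) : Prop :=
  [/\ leader v l, all_in_view E i v &
      if i is j.+1 then ~ all_in_view E j v else True].

Definition view_synchronized (R : realType) (n : nat) (V : Type) (Delta : R)
    (E : trace R n V) : Prop :=
  [/\ (* a change of view number is an increase *)
      forall i v, correct E (actor E i) -> ev E i = NewView v ->
        (view_at E (actor E i) i < v)%N,
      forall N, exists i v l, [/\ (N <= i)%N, correct E l & elected_at E i v l] &
      forall i v l, correct E l -> elected_at E i v l ->
        gst E <= config_time E i ->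
        forall j w, (i <= j)%N -> correct E (actor E j) -> ev E j = NewView w ->
          config_time E i + 5%:R * Delta <= time E j].

Record execution (R : realType) (n : nat) (V : Type) (Delta : R)
    (P : protocol R n V) (E : trace R n V) : Prop := Execution {
  exec_time : time_wf E;
  exec_clocks : clocks_wf E;
  exec_start : starts_at_0 E;
  exec_running : keeps_running E;
  exec_follows : follows P E;
  exec_unforgeable : unforgeable E;
  exec_authenticated : authenticated E;
  exec_no_duplication : no_duplication E;
  exec_no_loss : no_loss E;
  exec_synchrony : partially_synchronous Delta E;
  exec_views : view_synchronized Delta E
}.

Definition decides_once (R : realType) (n : nat) (V : Type) (E : trace R n V) :
    Prop :=
  forall p i k x i' k' x', correct E p ->
    decides_at E i k p x -> decides_at E i' k' p x' -> i = i' /\ k = k'.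

Definition liveness (R : realType) (n : nat) (V : Type) (E : trace R n V) :
    Prop :=
  forall p, correct E p -> exists i k x, decides_at E i k p x.

Definition consistency (R : realType) (n : nat) (V : Type) (E : trace R n V) :
    Prop :=
  forall p q i k x j k' y, correct E p -> correct E q ->
    decides_at E i k p x -> decides_at E j k' q y -> x = y.

Definition extended_validity (R : realType) (n : nat) (V : Type)
    (E : trace R n V) : Prop :=
  (forall p, correct E p) ->
  forall p i k x, decides_at E i k p x -> exists q, x = input E q.

Definition solves_consensus (R : realType) (n : nat) (V : Type) (Delta : R)
    (f : nat) (P : protocol R n V) : Prop :=
  forall E : trace R n V, execution Delta P E -> (#|byz E| <= f)%N ->
    [/\ decides_once E, liveness E, consistency E & extended_validity E].

Definition fast (R : realType) (n : nat) (V : Type) (Delta : R) (t : nat)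
    (l : 'I_n) (P : protocol R n V) : Prop :=
  forall E : trace R n V, execution Delta P E ->
    correct E l -> (#|byz E| <= t)%N -> gst E = 0 ->
    forall p, correct E p ->
      exists i k x, decides_at E i k p x /\ time E i <= 2%:R * Delta.

Definition fast_byzantine_consensus (R : realType) (n : nat) (V : Type)
    (Delta : R) (f t : nat) (P : protocol R n V) : Prop :=
  [/\ respects_keys P, solves_consensus Delta f P &
      exists l : 'I_n, leader 1 l /\ fast Delta t l P].

(* Main.v *)
Require Import Defs.
From mathcomp Require Import all_boot all_order all_algebra.
From mathcomp Require Import zify lra.
From mathcomp Require Import boolp reals.

(* In view 1 the leader signs its input and broadcasts it; every process
   broadcasts a signed acknowledgement, and n - t acknowledgements of view 1
   suffice to decide.  In any view, a quorum of acknowledgements forms a commit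
   certificate, whose holder broadcasts a commit message; a quorum of commit
   messages is the slow way to decide.  The leader of a view v > 1 first collects
   n - f signed votes, each with the proposal acknowledged in view 1 and the
   latest commit certificate of the voter, and attaches them to its proposal, so
   that everybody can check that the proposed value is compatible with every
   earlier decision.  Two votes with conflicting proposals of view 1 convict the
   leader of view 1; once its vote is discarded, at most f - 1 Byzantine votes
   remain, and a value decided on the fast path is the only one supported by
   f + t votes. *)

Set Implicit Arguments.
Unset Strict Implicit.
Unset Printing Implicit Defensive.

Import Order.TTheory GRing.Theory Num.Theory.

(** * Classical resolution of guards *)

Section ClassicalPick.
Variable T : Type.
Implicit Type P : T -> Prop.

(* The guards of the protocol are propositions, which cpick resolves classically
   but deterministically. *)
Definition cpick P : option T :=
  match pselect (exists x, P x) with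
  | left h => Some (projT1 (cid h))
  | right _ => None
  end.

Variant cpick_spec P : option T -> Prop :=
| CPickSome x of P x : cpick_spec P (Some x)
| CPickNone of (forall x, ~ P x) : cpick_spec P None.

Lemma cpickP P : cpick_spec P (cpick P).
Proof.
rewrite /cpick; case: pselect => [h|h]; constructor; first by case: cid.
by move=> x Px; apply: h; exists x.
Qed.

Lemma cpick_Some P x : cpick P = Some x -> P x.
Proof. by case: cpickP => // y Py [<-]. Qed.

End ClassicalPick.

(** * Occurrence of an action in the output of a step *)

Section Emits.
Variable T : Type.
Implicit Types (s : seq T) (a : T).

Definition emits s a := exists k, onth s k = Some a.

Lemma emits_nil a : emits [::] a <-> False.
Proof. by split=> // -[k]; rewrite onth0n. Qed.

Lemma emits_seq1 b a : emits [:: b] a <-> a = b.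
Proof. by split=> [[k /onth1P [_ ->]]|->] //; exists 0. Qed.

Lemma emits_cat s1 s2 a : emits (s1 ++ s2) a <-> emits s1 a \/ emits s2 a.
Proof.
split=> [[k]|[[k h]|[k h]]].
- by rewrite onth_cat; case: ifP => _ h; [left|right]; eexists; exact: h.
- by exists k; rewrite onth_cat ifT // -(onthTE s1 k) h.
- exists (size s1 + k); rewrite onth_cat ifF ?addKn //.
  by rewrite ltnNge leq_addr.
Qed.

End Emits.

Definition bcast n V (m : msg n V) := [seq Send d m | d <- enum 'I_n].

Lemma emits_bcast n V (m : msg n V) a :
  emits (bcast m) a <-> exists d, a = Send d m.
Proof.
split=> [[k]|[d ->]].
  by rewrite /bcast onth_map; case: onth => //= d [<-]; exists d.
have /onthP [k hk] : d \in enum 'I_n by rewrite mem_enum.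
by exists k; rewrite /bcast onth_map hk.
Qed.

(** * The protocol *)

Section Protocol.
Variables (R : realType) (n : nat) (V : eqType) (f t : nat).
Hypothesis n_gt0 : 0 < n.

Definition ldr (v : nat) : 'I_n := Ordinal (ltn_pmod v n_gt0).

Lemma leader_ldr v : leader v (ldr v).
Proof. by rewrite /leader. Qed.

Lemma leaderE v l : leader v l -> l = ldr v.
Proof. by move/eqP=> h; apply: val_inj. Qed.

(* The least integer at least (n + f + 1) / 2: two sets of that many processes
   share at least f + 1 processes. *)
Definition quorum := (n + f)./2.+1.

(** * Encoding of messages *)

Local Notation msg := (msg n V).
Local Notation cst k := (Const n V k).
Local Notation cert_data := (nat * V * {set 'I_n})%type.

Definition prop1 (x : V) : msg := Sign (ldr 1) (Val n x).

(** The bodies that get signed have three distinct shapes: a bare value, a number paired with a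
    value, and a vote, whose second component is again a pair. A signed body thus tells by itself
    what it stands for. *)
Definition ack_body (u : nat) (x : V) : msg := Pair (cst u) (Val n x).

Definition ack_msg (p : 'I_n) u x : msg := Sign p (ack_body u x).

(** Unsigned, since commit messages are never relayed: the authenticated channel identifies the
    sender. *)
Definition commit_msg (u : nat) (x : V) : msg := Pair (cst u) (Val n x).

Definition bundle (Q : {set 'I_n}) (body : 'I_n -> msg) : msg :=
  foldr (fun p m => Pair (Sign p (body p)) m) (cst 0) (enum Q).

Definition value_msg (a : option V) : msg :=
  if a is Some x then prop1 x else cst 0.

(** The body is repeated in the clear, so that view and value can be read off whatever [A] is. *)
Definition cert_msg (c : option cert_data) : msg :=
  if c is Some (u, x, A) then
    Pair (ack_body u x) (bundle A (fun=> ack_body u x))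
  else cst 0.

Definition vote_body (v : nat) (a : option V) (c : option cert_data) : msg :=
  Pair (cst v) (Pair (value_msg a) (cert_msg c)).

Definition prop_msg (v : nat) (x : V) (Q : {set 'I_n})
    (a : 'I_n -> option V) (c : 'I_n -> option cert_data) : msg :=
  Pair (cst v) (Pair (Val n x) (bundle Q (fun p => vote_body v (a p) (c p)))).

Definition support (Q : {set 'I_n}) (a : 'I_n -> option V) (x : V) : nat :=
  #|[set p in Q | a p == Some x]|.

(* The votes of Q carry the values a acknowledged in view 1 and the latest
   commit certificates c.  Only view 1 has a fast path, so a commit certificate
   of maximal view settles the choice.  In its absence, conflicting values in
   the votes carry conflicting signatures of the leader of view 1 and thereby
   prove it Byzantine. *)
Definition justified (v : nat) (x : V) (Q : {set 'I_n})
    (a : 'I_n -> option V) (c : 'I_n -> option cert_data) : Prop :=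
  [/\ n - f <= #|Q|,
      forall p u y A, p \in Q -> c p = Some (u, y, A) ->
        u < v /\ quorum <= #|A| &
      (exists p u A, [/\ p \in Q, c p = Some (u, x, A) &
         forall p' u' y A', p' \in Q -> c p' = Some (u', y, A') -> u' <= u]) \/
      (forall p, p \in Q -> c p = None) /\
      ((forall p y, p \in Q -> a p = Some y -> y = x) \/
       [/\ ldr 1 \notin Q,
           exists p p' y z, [/\ p \in Q, p' \in Q, a p = Some y, a p' = Some z &
             y != z] &
           f + t <= support Q a x \/ forall y, support Q a y < f + t])].

(** * Local state and guards *)

Record st := St {
  inp : V;
  view : nat;
  rcvd : 'I_n -> msg -> Prop;
  props : nat -> option V;
  acks : nat -> option V;
  cert : option cert_data;
  decd : bool
}.

Definition init_st (_ : 'I_n) (x : V) : st :=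
  St x 1 (fun _ _ => False) (fun=> None) (fun=> None) None false.

(** The last clause serves extended validity: when the votes carry neither values nor certificates,
    [justified] admits any value. *)
Definition can_propose (p : 'I_n) (s : st)
    (w : V * {set 'I_n} * ('I_n -> option V) * ('I_n -> option cert_data)) :=
  let: (x, Q, a, c) := w in
  [/\ 1 < view s /\ p = ldr (view s), props s (view s) = None,
      forall p', p' \in Q -> rcvd s p' (Sign p' (vote_body (view s) (a p') (c p'))),
      justified (view s) x Q a c &
      x = inp s \/ exists p', p' \in Q /\
        (a p' = Some x \/ exists u A, c p' = Some (u, x, A))].

Definition acceptable (s : st) (x : V) : Prop :=
  if view s == 1 then rcvd s (ldr 1) (prop1 x) else
  exists Q a c, rcvd s (ldr (view s)) (prop_msg (view s) x Q a c) /\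
    justified (view s) x Q a c.

Definition can_ack (s : st) (x : V) : Prop :=
  acks s (view s) = None /\ acceptable s x.

Definition can_commit (s : st) (w : V * {set 'I_n}) : Prop :=
  [/\ forall y B, cert s <> Some (view s, y, B), quorum <= #|w.2| &
      forall p, p \in w.2 -> rcvd s p (ack_msg p (view s) w.1)].

Definition decidable_value (s : st) (x : V) : Prop :=
  (exists u (C : {set 'I_n}), quorum <= #|C| /\
     forall p, p \in C -> rcvd s p (commit_msg u x)) \/
  (exists C : {set 'I_n}, n - t <= #|C| /\
     forall p, p \in C -> rcvd s p (ack_msg p 1 x)).

Definition can_decide (s : st) (x : V) : Prop :=
  decd s = false /\ decidable_value s x.

(** * The transition function *)

Definition receive (s : st) (e : event n V) : st :=
  let: St i v r pr ak c d := s in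
  match e with
  | Recv q m => St i v (fun q' m' => r q' m' \/ (q' = q /\ m' = m)) pr ak c d
  | NewView w => if v < w then St i w r pr ak c d else s
  | _ => s
  end.

Definition upd (g : nat -> option V) (v : nat) (x : V) (u : nat) : option V :=
  if u == v then Some x else g u.

Definition respond (p : 'I_n) (s : st) : st :=
  St (inp s) (view s) (rcvd s)
    (if cpick (can_propose p s) is Some (x, _, _, _)
     then upd (props s) (view s) x else props s)
    (if cpick (can_ack s) is Some x then upd (acks s) (view s) x else acks s)
    (if cpick (can_commit s) is Some (x, A) then Some (view s, x, A)
     else cert s)
    (if cpick (can_decide s) is Some _ then true else decd s).

(** The vote is built from the state before the step, so that its certificate has a view below [v],
    as [justified] demands. *)
Definition announce (p : 'I_n) (s : st) (e : event n V) : seq (action n V) :=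
  match e with
  | Start => if p == ldr 1 then bcast (prop1 (inp s)) else [::]
  | NewView v => if view s < v
      then [:: Send (ldr v) (Sign p (vote_body v (acks s 1) (cert s)))]
      else [::]
  | _ => [::]
  end.

(** The decision comes first, hence always at index 0; [decides_once] compares indices too. *)
Definition response (p : 'I_n) (s : st) : seq (action n V) :=
  (if cpick (can_decide s) is Some x then [:: Decide x] else [::]) ++
  (if cpick (can_propose p s) is Some (x, Q, a, c)
   then bcast (prop_msg (view s) x Q a c) else [::]) ++
  (if cpick (can_ack s) is Some x then bcast (ack_msg p (view s) x)
   else [::]) ++
  (if cpick (can_commit s) is Some (x, _) then bcast (commit_msg (view s) x)
   else [::]).

Definition stp (p : 'I_n) (s : st) (e : event n V) : st * seq (action n V) :=
  let s1 := receive s e in (respond p s1, response p s1 ++ announce p s e).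

Definition fast_protocol : protocol R n V :=
  Protocol init_st (fun p _ s e => stp p s e).

(** * Steps and signatures *)

Lemma signature_in_bundle q b Q body :
  signature_in q b (bundle Q body) <->
  q \in Q /\ b = body q \/ exists2 p, p \in Q & signature_in q b (body p).
Proof.
rewrite /bundle.
have -> : (q \in Q) = (q \in enum Q) by rewrite mem_enum.
have -> : (exists2 p, p \in Q & signature_in q b (body p)) <->
          (exists2 p, p \in enum Q & signature_in q b (body p)).
  by split=> -[p hp]; exists p => //; move: hp; rewrite mem_enum.
elim: (enum Q) => [|p r IH] /=.
  by split=> // -[[]|[]].
split=> [[[[-> <-]|h]|h]|].
- by left; rewrite inE eqxx.
- by right; exists p => //; rewrite inE eqxx.
- case/IH: h => [[hq ->]|[p' hp' h']].
    by left; rewrite inE hq orbT.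
  by right; exists p' => //; rewrite inE hp' orbT.
case=> [[]|[p']]; rewrite inE => /orP[/eqP->|hp].
- by move=> ->; left; left.
- by move=> hb; right; apply/IH; left.
- by move=> h; left; right.
- by move=> h; right; apply/IH; right; exists p'.
Qed.

Lemma signature_in_vote q b v a c :
  signature_in q b (vote_body v a c) ->
  (exists x, [/\ a = Some x, q = ldr 1 & b = Val n x]) \/
  (exists u x A, [/\ c = Some (u, x, A), q \in A & b = ack_body u x]).
Proof.
case=> // -[].
  by case: a => //= x [[<- <-]|//]; left; exists x.
case: c => // -[[u x] A] /= [[] //|].
case/signature_in_bundle=> [[hq ->]|[? _ []] //].
by right; exists u, x, A.
Qed.

(** * Effect of one step on the state and on the output *)

Section Step.
Variables (p : 'I_n) (s : st) (e : event n V).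

Local Notation s1 := (receive s e).
Local Notation s' := (stp p s e).1.
Local Notation out := (stp p s e).2.

Lemma inp_receive : inp s1 = inp s.
Proof. by case: s e => i v ? ? ? ? ? [||w|] //=; case: ifP. Qed.

Lemma props_receive : props s1 = props s.
Proof. by case: s e => i v ? ? ? ? ? [||w|] //=; case: ifP. Qed.

Lemma acks_receive : acks s1 = acks s.
Proof. by case: s e => i v ? ? ? ? ? [||w|] //=; case: ifP. Qed.

Lemma cert_receive : cert s1 = cert s.
Proof. by case: s e => i v ? ? ? ? ? [||w|] //=; case: ifP. Qed.

Lemma decd_receive : decd s1 = decd s.
Proof. by case: s e => i v ? ? ? ? ? [||w|] //=; case: ifP. Qed.

Lemma inp_stp : inp s' = inp s.
Proof. exact: inp_receive. Qed.

Lemma rcvd_stp q m : rcvd s' q m <-> rcvd s q m \/ e = Recv q m.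
Proof.
case: s e => i v r ? ? ? ? [|q' m'|w|] /=; first 1 last.
- by split=> -[h|]; [by left|by move=> [-> ->]; right|by left|by case=> -> ->; right].
- by case: ifP => _ /=; split=> [|[]//]; left.
- by split=> [|[]//]; left.
- by split=> [|[]//]; left.
Qed.

Lemma view_stp :
  view s' = if e is NewView w then maxn (view s) w else view s.
Proof.
case: s e => i v ? ? ? ? ? [||w|] //=.
by rewrite /maxn; case: ifP.
Qed.

Lemma view_stp_le : view s <= view s'.
Proof. by rewrite view_stp; case: e => // w; rewrite leq_maxl. Qed.

Lemma upd_SomeP g v x u y :
  upd g v x u = Some y -> g u = Some y \/ u = v /\ x = y.
Proof.
by rewrite /upd; case: eqP => [-> [->]|]; [right|left].
Qed.

Lemma props_stp_mono u x : props s u = Some x -> props s' u = Some x.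
Proof.
move=> h; rewrite /= /respond /=; case: cpickP => [[[[y Q] a] c] [_]|_].
  rewrite props_receive /upd => hn _ _ _; case: eqP => // hu.
  by rewrite -hu h in hn.
by rewrite props_receive.
Qed.

Lemma acks_stp_mono u x : acks s u = Some x -> acks s' u = Some x.
Proof.
move=> h; rewrite /= /respond /=; case: cpickP => [y []|_].
  rewrite acks_receive /upd => hn _; case: eqP => // hu.
  by rewrite -hu h in hn.
by rewrite acks_receive.
Qed.

Lemma decd_stp_mono : decd s -> decd s'.
Proof.
by rewrite /= /respond /=; case: cpickP => // _; rewrite decd_receive.
Qed.

Lemma props_stp u x : props s' u = Some x ->
  props s u = Some x \/
  [/\ u = view s', 1 < u, p = ldr u, props s u = None &
   exists (Q : {set 'I_n}) a c,
    [/\ forall p', p' \in Q -> rcvd s' p' (Sign p' (vote_body u (a p') (c p'))),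
        justified u x Q a c,
        x = inp s \/ exists p', p' \in Q /\
          (a p' = Some x \/ exists v A, c p' = Some (v, x, A)) &
        forall d, emits out (Send d (prop_msg u x Q a c))]].
Proof.
rewrite /= /respond /response /=; case: cpickP => [[[[y Q] a] c]|_]; last first.
  by rewrite props_receive; left.
case=> -[hv hp]; rewrite inp_receive props_receive => hn hr hj hx.
case/upd_SomeP=> [|[hu hy]]; first by left.
subst y; right; rewrite hu; split => //; exists Q, a, c; split => // d.
apply/emits_cat; left; apply/emits_cat; right; apply/emits_cat; left.
by apply/emits_bcast; exists d.
Qed.

Lemma acks_stp u x : acks s' u = Some x ->
  acks s u = Some x \/
  [/\ u = view s', acceptable s' x &
      forall d, emits out (Send d (ack_msg p u x))].
Proof.
rewrite /= /respond /response /=; case: (cpickP (can_ack _)) => [y|_]; last first.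
  by rewrite acks_receive; left.
rewrite /can_ack acks_receive => -[hn hacc].
case/upd_SomeP=> [|[hu hy]]; first by left.
subst y; right; rewrite hu; split => // d.
apply/emits_cat; left; do 2 (apply/emits_cat; right); apply/emits_cat; left.
by apply/emits_bcast; exists d.
Qed.

Lemma cert_stp :
  cert s' = cert s \/
  exists x A, [/\ cert s' = Some (view s', x, A), quorum <= #|A|,
    forall p', p' \in A -> rcvd s' p' (ack_msg p' (view s') x) &
    forall d, emits out (Send d (commit_msg (view s') x))].
Proof.
rewrite /= /respond /response /=; case: (cpickP (can_commit _)) => [[x A]|_]; last first.
  by rewrite cert_receive; left.
case=> _ /= hA hr; right; exists x, A; split => // d.
apply/emits_cat; left; do 3 (apply/emits_cat; right).
by apply/emits_bcast; exists d.
Qed.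

Lemma decd_stp : decd s' -> decd s \/ exists x, emits out (Decide x).
Proof.
rewrite /= /respond /response /=; case: (cpickP (can_decide _)) => [x|_]; last first.
  by rewrite decd_receive; left.
move=> _ _; right; exists x; apply/emits_cat; left; apply/emits_cat; left.
exact/emits_seq1.
Qed.

(** Inversion principle for outgoing messages: proposals, acknowledgements and commits are tied to
    the record they leave in the state after the step, from which a receiver's message leads back to
    the sender's state. *)
Variant sent (d : 'I_n) (m : msg) : Prop :=
| SentProp x Q a c of m = prop_msg (view s') x Q a c
    & props s' (view s') = Some x
    & (forall p', p' \in Q ->
        rcvd s' p' (Sign p' (vote_body (view s') (a p') (c p'))))
    & (x = inp s \/ exists p', p' \in Q /\
        (a p' = Some x \/ exists u A, c p' = Some (u, x, A)))
    & justified (view s') x Q a c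
| SentAck x of m = ack_msg p (view s') x & acks s' (view s') = Some x
| SentCommit x A of m = commit_msg (view s') x
    & cert s' = Some (view s', x, A)
| SentFirst of m = prop1 (inp s) & e = Start & p = ldr 1
| SentVote v of e = NewView v & view s < v & d = ldr v
    & m = Sign p (vote_body v (acks s 1) (cert s)).

Lemma stp_sent d m : emits out (Send d m) -> sent d m.
Proof.
case/emits_cat; last first.
  rewrite /announce; case E: e => [|q m'|v|]; try by move/emits_nil.
    case: eqP => [hp|_]; last by move/emits_nil.
    by case/emits_bcast=> d' [_ ->]; apply: SentFirst.
  case: ifP => [hv|_]; last by move/emits_nil.
  by case/emits_seq1=> -> ->; apply: (@SentVote _ _ v).
case/emits_cat; first by case: cpickP => [x _ /emits_seq1 //|_ /emits_nil].
case/emits_cat.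
  case E: cpick => [[[[x Q] a] c]|]; last by move/emits_nil.
  case/emits_bcast=> d' [_ ->].
  case: (cpick_Some E)=> -[hv hp] hn hr hj hx.
  apply: (@SentProp _ _ x Q a c) => //; last by rewrite -inp_receive.
  by rewrite /= E /upd eqxx.
case/emits_cat.
  case E: cpick => [x|]; last by move/emits_nil.
  case/emits_bcast=> d' [_ ->].
  by apply: (@SentAck _ _ x) => //; rewrite /= E /upd eqxx.
case E: cpick => [[x A]|]; last by move/emits_nil.
case/emits_bcast=> d' [_ ->].
by apply: (@SentCommit _ _ x A) => //; rewrite /= E.
Qed.

Lemma stp_decide k x : onth out k = Some (Decide x) ->
  [/\ k = 0, decidable_value s' x, decd s = false & decd s'].
Proof.
(* Nothing behind the first slot of the output is a decision. *)
have notail : ~ emits ((if cpick (can_propose p s1) is Some (y, Q, a, c)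
     then bcast (prop_msg (view s1) y Q a c) else [::]) ++
    (if cpick (can_ack s1) is Some y then bcast (ack_msg p (view s1) y)
     else [::]) ++
    (if cpick (can_commit s1) is Some (y, _) then bcast (commit_msg (view s1) y)
     else [::]) ++ announce p s e) (Decide x).
  case/emits_cat; first by case: cpick => [[[[y Q] a] c]|] => [/emits_bcast []|/emits_nil].
  case/emits_cat; first by case: cpick => [y|] => [/emits_bcast []|/emits_nil].
  case/emits_cat; first by case: cpick => [[y A]|] => [/emits_bcast []|/emits_nil].
  case: e => [|q m'|v|] /=; try by move/emits_nil.
    by case: eqP => _ => [/emits_bcast []|/emits_nil].
  by case: ifP => _ => [/emits_seq1|/emits_nil].
rewrite /= /response -!catA /respond /=.
case: (cpickP (can_decide _)) => [y [hd hy]|_ h]; last by case: notail; exists k.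
case: k => [[<-]|k h]; last by case: notail; exists k.
by rewrite -decd_receive.
Qed.

(** The source of all progress: as no guard is enabled after a step, whatever the received messages
    permit has already been done. *)
Definition settled (r : st) : Prop :=
  [/\ forall w, ~ can_propose p r w, forall x, ~ can_ack r x,
      forall w, ~ can_commit r w & forall x, ~ can_decide r x].

Lemma settled_stp : settled s'.
Proof.
split=> [[[[x Q] a] c]|x|[x A]|x]; rewrite /= /respond.
- case: cpickP => [[[[y B] b] d] _ [_]|hn [h1 h2 h3 h4 h5]].
    by rewrite /= /upd eqxx.
  by apply: (hn (x, Q, a, c)).
- case: (cpickP (can_ack _)) => [y _ []|hn [h1 h2]].
    by rewrite /= /upd eqxx.
  by apply: (hn x).
- case: (cpickP (can_commit _)) => [[y B] _ [h _ _]|hn [h1 h2 h3]].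
    exact: (h y B).
  by apply: (hn (x, A)).
- case: (cpickP (can_decide _)) => [y _ []//|hn [h1 h2]].
  by apply: (hn x).
Qed.

Lemma emits_first : e = Start -> p = ldr 1 ->
  forall d, emits out (Send d (prop1 (inp s))).
Proof.
move=> he hp d; apply/emits_cat; right; rewrite he /= hp eqxx.
by apply/emits_bcast; exists d.
Qed.

Lemma emits_vote v : e = NewView v -> view s < v ->
  emits out (Send (ldr v) (Sign p (vote_body v (acks s 1) (cert s)))).
Proof.
by move=> he hv; apply/emits_cat; right; rewrite he /= hv; exact/emits_seq1.
Qed.

End Step.

(** * State invariant and origin of signatures *)

Definition inv (s : st) : Prop :=
  [/\ 0 < view s,
      forall x, acks s 1 = Some x -> rcvd s (ldr 1) (prop1 x) &
      forall u x A, cert s = Some (u, x, A) ->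
        [/\ 0 < u, u <= view s, quorum <= #|A| &
         forall p, p \in A -> rcvd s p (ack_msg p u x)]].

Lemma inv_init p x : inv (init_st p x).
Proof. by []. Qed.

Lemma inv_stp p s e : inv s -> inv (stp p s e).1.
Proof.
case=> hv ha hc; split.
- exact: leq_trans hv (view_stp_le _ _ _).
- move=> x /acks_stp[/ha h|[hu + _]]; first by apply/rcvd_stp; left.
  by rewrite /acceptable -hu eqxx.
- have hv' : 0 < view (stp p s e).1 by exact: leq_trans hv (view_stp_le _ _ _).
  move=> u x A; case: (cert_stp p s e) => [->|[y [B [-> hB hr _]]]].
    case/hc=> h1 h2 h3 h4; split => //.
      exact: leq_trans h2 (view_stp_le _ _ _).
    by move=> q /h4 h; apply/rcvd_stp; left.
  by case=> <- <- <-.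
Qed.

(** The bodies that a process following the protocol signs itself; every other signature it sends is
    relayed. *)
Variant fresh (p : 'I_n) (s : st) (e : event n V) (s' : st) (b : msg) : Prop :=
| FreshFirst of p = ldr 1 & e = Start & b = Val n (inp s)
| FreshAck v x of b = ack_body v x & acks s' v = Some x
| FreshVote v of e = NewView v & view s < v
    & b = vote_body v (acks s 1) (cert s).

(** A proposal bundles votes that were received. A vote relays the signed value of the first leader
    and the acknowledgements of a certificate, which were received by [inv]. The remaining
    signatures are fresh. *)
Lemma sent_signature p s e d m q b : inv s ->
  emits (stp p s e).2 (Send d m) -> signature_in q b m ->
  q = p /\ fresh p s e (stp p s e).1 b \/
  exists q' m', rcvd (stp p s e).1 q' m' /\ signature_in q b m'.
Proof.
move=> hinv /stp_sent [].
- move=> x Q a c -> _ hr _ _ /= [//|[//|]].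
  case/signature_in_bundle=> [[hq ->]|[p' hp' h]].
    right; exists q, (Sign q (vote_body (view (stp p s e).1) (a q) (c q))).
    by split; [exact: hr|left].
  right; exists p', (Sign p' (vote_body (view (stp p s e).1) (a p') (c p'))).
  by split; [exact: hr|right].
- move=> x -> hx /= [[<- <-]|[]//]; left; split=> //.
  exact: FreshAck hx.
- by move=> x A -> _ /= [].
- by move=> -> he hp /= [[<- <-]|//]; left; split=> //; exact: FreshFirst.
- move=> v he hv _ ->; case=> [[<- <-]|]; first by left; split=> //; exact: FreshVote hv _.
  case: hinv => _ ha hc.
  case/(@signature_in_vote q b v)=> [[x [/ha h -> ->]]|[u [x [A [/hc [_ _ _ h] hq ->]]]]].
    right; exists (ldr 1), (prop1 x); split; last by left.
    by apply/rcvd_stp; left.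
  right; exists q, (ack_msg q u x); split; last by left.
  by apply/rcvd_stp; left; exact: h.
Qed.

Lemma inv_run p x h : inv (run fast_protocol p x h).
Proof.
elim/last_ind: h => [|h [c e] IH]; first exact: inv_init.
by rewrite /run foldl_rcons; exact: inv_stp.
Qed.

Lemma rcvd_run p x h q m : rcvd (run fast_protocol p x h) q m ->
  exists j, onth (unzip2 h) j = Some (Recv q m).
Proof.
elim/last_ind: h => [//|h [c e] IH]; rewrite /run foldl_rcons.
rewrite /unzip2 map_rcons -cats1 /=.
case/(rcvd_stp p)=> [/IH [j hj]|->].
  by apply/emits_cat; left; exists j.
by apply/emits_cat; right; exists 0.
Qed.

Lemma fast_protocol_respects_keys : respects_keys fast_protocol.
Proof.
move=> p x h c e k d m q b hk hs hqp.
case: (sent_signature (inv_run p x h) (ex_intro _ k hk) hs) => [[]//|].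
move=> [q' [m' [hr hs']]].
(* The state after the step is the run of the extended history, so a message received in this very
   step counts. *)
have := @rcvd_run p x (rcons h (c, e)) q' m'.
rewrite {1}/run foldl_rcons /unzip2 map_rcons => /(_ hr) [j hj].
by exists j, q', m'.
Qed.

Lemma value_msg_inj : injective value_msg.
Proof. by case=> [x|] [y|] //= [->]. Qed.

Lemma cert_msg_inj c c' : cert_msg c = cert_msg c' -> omap fst c = omap fst c'.
Proof. by case: c => [[[u x] A]|]; case: c' => [[[v y] B]|] //= [-> ->]. Qed.

Lemma fresh_ack p s e s' u x : fresh p s e s' (ack_body u x) -> acks s' u = Some x.
Proof. by case=> // v y [-> ->]. Qed.

Lemma fresh_value p s e s' x : fresh p s e s' (Val n x) -> e = Start /\ x = inp s.
Proof. by case=> // _ -> [->]. Qed.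

Lemma fresh_vote p s e s' v a c : fresh p s e s' (vote_body v a c) ->
  [/\ e = NewView v, view s < v, a = acks s 1 & omap fst c = omap fst (cert s)].
Proof.
case=> // w -> hw [-> /value_msg_inj -> /cert_msg_inj ->]; by split.
Qed.

(** * Executions *)

Section Execution.
Variables (Delta : R) (E : trace R n V).
Hypothesis hE : execution Delta fast_protocol E.

Definition sta (p : 'I_n) (i : nat) : st := state_at fast_protocol E p i.

Lemma staS p i : sta p i.+1 =
  if actor E i == p then (stp p (sta p i) (ev E i)).1 else sta p i.
Proof. by []. Qed.

Lemma staE p i : actor E i = p -> sta p i.+1 = (stp p (sta p i) (ev E i)).1.
Proof. by rewrite staS => ->; rewrite eqxx. Qed.

Lemma acts_stp p i : correct E p -> actor E i = p ->
  acts E i = (stp p (sta p i) (ev E i)).2.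
Proof. by move=> hp h; have := exec_follows hE; move=> /(_ i); rewrite h => ->. Qed.

Lemma sends_atP i k p d m : correct E p -> sends_at E i k p d m ->
  actor E i = p /\ emits (stp p (sta p i) (ev E i)).2 (Send d m).
Proof. by move=> hp [ha hk]; split=> //; rewrite -acts_stp //; exists k. Qed.

Lemma emits_sends_at i p d m : correct E p -> actor E i = p ->
  emits (stp p (sta p i) (ev E i)).2 (Send d m) -> exists k, sends_at E i k p d m.
Proof. by move=> hp ha; rewrite -acts_stp // => -[k hk]; exists k. Qed.

Lemma sta_mono (P : st -> Prop) p i j :
  (forall s e, P s -> P (stp p s e).1) -> i <= j -> P (sta p i) -> P (sta p j).
Proof.
move=> hP /subnKC <-; elim: (j - i) => [|k IH] hi; first by rewrite addn0.
by rewrite addnS staS; case: eqP => _; [apply: hP|]; apply: IH.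
Qed.

Lemma inv_sta p i : inv (sta p i).
Proof. by apply: (@sta_mono inv p 0) => // s e; apply: inv_stp. Qed.

Lemma inp_sta p i : inp (sta p i) = input E p.
Proof.
by apply: (@sta_mono (fun s => inp s = _) p 0) => // s e; rewrite inp_stp.
Qed.

Lemma view_sta_le p i j : i <= j -> view (sta p i) <= view (sta p j).
Proof.
move=> hij; apply: (@sta_mono (fun s => _ <= view s) p i) => // s e h.
exact: leq_trans h (view_stp_le p s e).
Qed.

Lemma acks_sta_mono p u x i j : i <= j ->
  acks (sta p i) u = Some x -> acks (sta p j) u = Some x.
Proof.
move=> hij; apply: (@sta_mono (fun s => acks s u = _)) => // s e.
exact: acks_stp_mono.
Qed.

Lemma props_sta_mono p u x i j : i <= j ->
  props (sta p i) u = Some x -> props (sta p j) u = Some x.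
Proof.
move=> hij; apply: (@sta_mono (fun s => props s u = _)) => // s e.
exact: props_stp_mono.
Qed.

Lemma decd_sta_mono p i j : i <= j -> decd (sta p i) -> decd (sta p j).
Proof.
by move=> hij; apply: (@sta_mono (fun s => decd s)) => // s e; apply: decd_stp_mono.
Qed.

Lemma acks_sta_inj p u x y i j :
  acks (sta p i) u = Some x -> acks (sta p j) u = Some y -> x = y.
Proof.
move=> /(acks_sta_mono (leq_maxl i j)) h /(acks_sta_mono (leq_maxr i j)).
by rewrite h => -[].
Qed.

Lemma props_sta_inj p u x y i j :
  props (sta p i) u = Some x -> props (sta p j) u = Some y -> x = y.
Proof.
move=> /(props_sta_mono (leq_maxl i j)) h /(props_sta_mono (leq_maxr i j)).
by rewrite h => -[].
Qed.

Lemma cert_sta_mono p i j u x A : i <= j -> cert (sta p i) = Some (u, x, A) ->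
  exists u' y B, cert (sta p j) = Some (u', y, B) /\ u <= u'.
Proof.
(* The invariant is carried along: it bounds the view of the old certificate by the current view,
   which is the view of any new certificate. *)
move=> hij hc; have [] : inv (sta p j) /\
  exists u' y B, cert (sta p j) = Some (u', y, B) /\ u <= u'; last by [].
apply: (@sta_mono (fun s => inv s /\ exists u' y B,
  cert s = Some (u', y, B) /\ u <= u') p i) => //.
  move=> s e [hi [u' [y [B [hs hu]]]]]; split; first exact: inv_stp.
  case: (cert_stp p s e) => [->|[z [C [-> _ _ _]]]]; first by exists u', y, B.
  exists (view (stp p s e).1), z, C; split => //.
  case: hi => _ _ /(_ _ _ _ hs) [_ h _ _].
  exact: leq_trans hu (leq_trans h (view_stp_le p s e)).
by split; [exact: inv_sta|exists u, x, A].
Qed.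

Lemma receives_rcvd p q m r i : receives_at E r q p m -> r < i ->
  rcvd (sta p i) q m.
Proof.
case=> ha he hri; apply: (@sta_mono (fun s => rcvd s q m) p r.+1) => //.
  by move=> s e h; apply/rcvd_stp; left.
by rewrite staE //; apply/rcvd_stp; right.
Qed.

Lemma rcvd_receives p q m i : rcvd (sta p i) q m ->
  exists2 r, r < i & receives_at E r q p m.
Proof.
elim: i => [//|i IH]; rewrite staS; case: eqP => [ha|_]; last first.
  by case/IH=> r hr h; exists r => //; exact: ltnW.
case/rcvd_stp=> [/IH[r hr h]|h]; first by exists r => //; exact: ltnW.
by exists i.
Qed.

(** Bounding [r.+1] makes even the state right after the sending step strictly earlier than [i], as
    inductions over time require. *)
Lemma rcvd_sent p q m i : correct E p -> rcvd (sta p i) q m ->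
  exists r k, r.+1 < i /\ sends_at E r k q p m.
Proof.
move=> hp /rcvd_receives [r hr h].
have [hs h'] := exec_authenticated hE hp h.
by exists (source E r).1, (source E r).2; split => //; exact: leq_ltn_trans hs hr.
Qed.

(** * Locating state changes and signatures in the trace *)

Lemma acks_origin p i u x : correct E p -> acks (sta p i) u = Some x ->
  exists j, [/\ j < i, actor E j = p, view (sta p j.+1) = u,
    acks (sta p j.+1) u = Some x & acceptable (sta p j.+1) x] /\
    forall d, exists k, sends_at E j k p d (ack_msg p u x).
Proof.
move=> hp; elim: i => [//|i IH] h.
case: (eqVneq (actor E i) p) => [ha|hna]; last first.
  move: h; rewrite staS (negPf hna) => /IH [j [[h1 h2 h3 h4 h5] h6]].
  by exists j; do 2 split => //; exact: ltnW.
move: (h); rewrite {1}staE //.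
case/acks_stp=> [/IH [j [[h1 h2 h3 h4 h5] h6]]|[hu hacc hout]].
  by exists j; do 2 split => //; exact: ltnW.
exists i; split; first by split=> //; rewrite staE.
by move=> d; apply: emits_sends_at.
Qed.

Lemma props_origin p i u x : correct E p -> props (sta p i) u = Some x ->
  exists j, [/\ j < i, actor E j = p, view (sta p j.+1) = u, 1 < u & p = ldr u] /\
    exists (Q : {set 'I_n}) a c,
    [/\ forall p', p' \in Q ->
          rcvd (sta p j.+1) p' (Sign p' (vote_body u (a p') (c p'))),
        justified u x Q a c,
        x = input E p \/ exists p', p' \in Q /\
          (a p' = Some x \/ exists v A, c p' = Some (v, x, A)) &
        forall d, exists k, sends_at E j k p d (prop_msg u x Q a c)].
Proof.
move=> hp; elim: i => [//|i IH] h.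
case: (eqVneq (actor E i) p) => [ha|hna]; last first.
  move: h; rewrite staS (negPf hna) => /IH [j [[h1 h2 h3 h4 h5] h6]].
  by exists j; do 2 split => //; exact: ltnW.
move: (h); rewrite {1}staE //.
case/props_stp=> [/IH [j [[h1 h2 h3 h4 h5] h6]]|[hu hu1 hl _ [Q [a [c [hr hj hx hout]]]]]].
  by exists j; do 2 split => //; exact: ltnW.
exists i; split; first by split=> //; rewrite staE.
exists Q, a, c; rewrite -(inp_sta p i) staE //; split => // d.
exact: emits_sends_at.
Qed.

Lemma cert_origin p i u x A : correct E p -> cert (sta p i) = Some (u, x, A) ->
  exists j, [/\ j < i, actor E j = p, view (sta p j.+1) = u &
    cert (sta p j.+1) = Some (u, x, A)] /\
    forall d, exists k, sends_at E j k p d (commit_msg u x).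
Proof.
move=> hp; elim: i => [//|i IH] h.
case: (eqVneq (actor E i) p) => [ha|hna]; last first.
  move: h; rewrite staS (negPf hna) => /IH [j [[h1 h2 h3 h4] h5]].
  by exists j; do 2 split => //; exact: ltnW.
case: (cert_stp p (sta p i) (ev E i)); rewrite -staE //.
  rewrite h => /esym /IH [j [[h1 h2 h3 h4] h5]].
  by exists j; do 2 split => //; exact: ltnW.
case=> y [B []]; rewrite h => -[hu hy hB] _ _ hout.
exists i; split; first by split.
by rewrite hu hy => d; apply: emits_sends_at.
Qed.

Lemma decd_origin p i : correct E p -> decd (sta p i) ->
  exists j k x, j < i /\ decides_at E j k p x.
Proof.
move=> hp; elim: i => [//|i IH] h.
case: (eqVneq (actor E i) p) => [ha|hna]; last first.
  move: h; rewrite staS (negPf hna) => /IH [j [k [x [h1 h2]]]].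
  by exists j, k, x; split => //; exact: ltnW.
move: h; rewrite staE //; case/decd_stp=> [/IH [j [k [x [h1 h2]]]]|[x [k hk]]].
  by exists j, k, x; split => //; exact: ltnW.
by exists i, k, x; split => //; split => //; rewrite (acts_stp hp ha).
Qed.

(** Strong induction on the step: a Byzantine sender must have the signature from an earlier message
    of [q], and a correct sender either issues it now or relays it from a message sent earlier. *)
Lemma signature_origin i k p d m q b : sends_at E i k p d m -> correct E q ->
  signature_in q b m ->
  exists j, [/\ j <= i, actor E j = q &
    fresh q (sta q j) (ev E j) (sta q j.+1) b].
Proof.
move=> hs hq; move: i k p d m hs; elim/ltn_ind => i IH k p d m hs hb.
case hp: (correct E p); last first.
  have [j [k' [d' [m' [hji hj hb']]]]] :=
    exec_unforgeable hE (negbT hp) hs hq hb.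
  have [j' [h1 h2 h3]] := IH _ hji _ _ _ _ hj hb'.
  by exists j'; split => //; exact: leq_trans h1 (ltnW hji).
have [ha hout] := sends_atP hp hs.
case: (sent_signature (inv_sta p i) hout hb) => [[hqp hf]|[q' [m' []]]].
  by exists i; rewrite hqp; split => //; rewrite staE.
rewrite -staE // => /(rcvd_sent hp) [r [k' [hr hsr]]] hb'.
have hri : r < i by [].
have [j' [h1 h2 h3]] := IH _ hri _ _ _ _ hsr hb'.
by exists j'; split => //; exact: leq_trans h1 (ltnW hri).
Qed.

Lemma rcvd_signature p i q' m q b : correct E p -> correct E q ->
  rcvd (sta p i) q' m -> signature_in q b m ->
  exists j, [/\ j.+1 < i, actor E j = q &
    fresh q (sta q j) (ev E j) (sta q j.+1) b].
Proof.
move=> hp hq /(rcvd_sent hp) [r [k [hr hs]]] hb.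
have [j [h1 h2 h3]] := signature_origin hs hq hb.
by exists j; split => //; exact: leq_ltn_trans hr.
Qed.

Lemma rcvd_ack p i q' m q u x : correct E p -> correct E q ->
  rcvd (sta p i) q' m -> signature_in q (ack_body u x) m ->
  exists2 j, j < i & acks (sta q j) u = Some x.
Proof.
move=> hp hq hr hs; have [j [h1 h2 /fresh_ack h3]] := rcvd_signature hp hq hr hs.
by exists j.+1.
Qed.

Lemma rcvd_value p i q' m q x : correct E p -> correct E q ->
  rcvd (sta p i) q' m -> signature_in q (Val n x) m -> x = input E q.
Proof.
move=> hp hq hr hs; have [j [_ _ /fresh_value [_ ->]]] := rcvd_signature hp hq hr hs.
exact: inp_sta.
Qed.

Lemma rcvd_vote p i q' m q v a c : correct E p -> correct E q ->
  rcvd (sta p i) q' m -> signature_in q (vote_body v a c) m ->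
  exists j, [/\ actor E j = q, ev E j = NewView v, view (sta q j) < v,
    a = acks (sta q j) 1 & omap fst c = omap fst (cert (sta q j))].
Proof.
move=> hp hq hr hs.
have [j [_ ha /fresh_vote [h1 h2 h3 h4]]] := rcvd_signature hp hq hr hs.
by exists j.
Qed.

Lemma view_after p j v : actor E j = p -> ev E j = NewView v ->
  v <= view (sta p j.+1).
Proof. by move=> ha he; rewrite staE // view_stp he leq_maxr. Qed.

(** Views never decrease, so an acknowledgement in view [u] precedes the step that enters [v], and
    the vote for [v] cannot omit it. *)
Lemma acks_before_view p i j u v x : correct E p ->
  actor E j = p -> ev E j = NewView v -> u < v ->
  acks (sta p i) u = Some x -> acks (sta p j) u = Some x.
Proof.
move=> hp ha he huv /(acks_origin hp) [k [[_ _ hv h _] _]].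
case: (leqP k.+1 j) => [hk|hk]; first exact: acks_sta_mono hk h.
have := leq_trans (view_after ha he) (view_sta_le p hk).
by rewrite hv leqNgt huv.
Qed.

(** As for acknowledgements, except that a certificate may have been replaced by one of a later
    view. *)
Lemma cert_before_view p i j u v x A : correct E p ->
  actor E j = p -> ev E j = NewView v -> u < v ->
  cert (sta p i) = Some (u, x, A) ->
  exists u' y B, cert (sta p j) = Some (u', y, B) /\ u <= u'.
Proof.
move=> hp ha he huv /(cert_origin hp) [k [[_ _ hv h] _]].
case: (leqP k.+1 j) => [hk|hk]; first exact: cert_sta_mono hk h.
have := leq_trans (view_after ha he) (view_sta_le p hk).
by rewrite hv leqNgt huv.
Qed.

(** * Safety *)

Hypothesis t_gt0 : 0 < t.
Hypothesis le_tf : t <= f.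
Hypothesis n_ge : 3 * f + 2 * t - 1 <= n.
Hypothesis byz_le : #|byz E| <= f.

(** * Quorums, locked values and chosen values *)

Definition acked p u x := exists i, acks (sta p i) u = Some x.

Definition committed p u x := exists i A, cert (sta p i) = Some (u, x, A).

(** Only correct members are constrained, since Byzantine ones may sign anything. Valid certificates
    and both ways of deciding yield locks, and a view locks at most one value. *)
Definition locked u x := exists A : {set 'I_n}, quorum <= #|A| /\
  forall p, p \in A -> correct E p -> acked p u x.

Definition slow_chosen u x := exists C : {set 'I_n}, quorum <= #|C| /\
  forall p, p \in C -> correct E p -> committed p u x.

Definition fast_chosen x := exists C : {set 'I_n}, n - t <= #|C| /\
  forall p, p \in C -> correct E p -> acked p 1 x.

Definition chosen u x := slow_chosen u x \/ u = 1 /\ fast_chosen x.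

(** The intersection has more than [f] members, too many to be all Byzantine. Taking [X = Y] gives a
    correct member of a quorum. *)
Lemma quorum_meet (X Y : {set 'I_n}) : n + f < #|X| + #|Y| ->
  exists p, [/\ p \in X, p \in Y & correct E p].
Proof.
move=> h; apply: contrapT => hn.
have /subset_leq_card hXY : X :&: Y \subset byz E.
  apply/subsetP=> p; rewrite inE => /andP[hX hY]; apply: contrapT => /negP hp.
  by apply: hn; exists p.
have hU : #|X :|: Y| <= n by rewrite -[leqRHS]card_ord max_card.
by have := cardsUI X Y; move: h hXY hU byz_le; lia.
Qed.

Lemma quorum_gt : n + f < 2 * quorum.
Proof.
by rewrite /quorum; have := odd_double_half (n + f); rewrite -mul2n; lia.
Qed.

(** Amounts to [3 * f + 1 <= n], which follows from [n_ge] because [t] is positive; the correct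
    processes alone then form a quorum. *)
Lemma quorum_le : quorum <= n - f.
Proof.
by rewrite /quorum; have := odd_double_half (n + f); rewrite -mul2n; lia.
Qed.

Lemma acked_inj p u x y : acked p u x -> acked p u y -> x = y.
Proof. by case=> i hi [j]; apply: acks_sta_inj hi. Qed.

Lemma locked_acked u x : locked u x -> exists2 p, correct E p & acked p u x.
Proof.
case=> A [hA h]; have [|p [hp _ hc]] := @quorum_meet A A.
  by have := quorum_gt; lia.
by exists p => //; apply: h.
Qed.

Lemma committed_locked p u x : correct E p -> committed p u x -> locked u x.
Proof.
move=> hp [i [A hc]]; have [_ _ /(_ _ _ _ hc) [_ _ hA hr]] := inv_sta p i.
exists A; split=> // q hq hcq.
have [|j _ h] := rcvd_ack (u := u) (x := x) hp hcq (hr _ hq); first by left.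
by exists j.
Qed.

Lemma slow_chosen_committed u x : slow_chosen u x ->
  exists2 p, correct E p & committed p u x.
Proof.
case=> A [hA h]; have [|p [hp _ hc]] := @quorum_meet A A.
  by have := quorum_gt; lia.
by exists p => //; apply: h.
Qed.

Lemma chosen_locked u x : chosen u x -> locked u x.
Proof.
case=> [/slow_chosen_committed [p hp]|[-> [C [hC h]]]].
  exact: committed_locked.
by exists C; split => //; have := quorum_le; lia.
Qed.

Lemma locked_inj u x y : locked u x -> locked u y -> x = y.
Proof.
move=> [A [hA hx]] [B [hB hy]].
have [|p [/hx h1 /hy h2 hp]] := @quorum_meet A B.
  by have := quorum_gt; lia.
exact: acked_inj (h1 hp) (h2 hp).
Qed.

Lemma locked_gt0 u x : locked u x -> 0 < u.
Proof.
case/locked_acked=> p hp [i /(acks_origin hp) [j [[_ _ <- _ _] _]]].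
by case: (inv_sta p j.+1).
Qed.

(* This is where the bound 3 f + 2 t - 1 saves one process: the leader of view 1
   is Byzantine and absent from Q. *)
Lemma fast_chosen_dissent (Q C : {set 'I_n}) (a : 'I_n -> option V) x :
  ~~ correct E (ldr 1) -> ldr 1 \notin Q -> n - t <= #|C| ->
  (forall p, p \in Q -> p \in C -> correct E p -> a p = Some x) ->
  #|[set p in Q | a p != Some x]| < f + t.
Proof.
rewrite /correct negbK => hl hlQ hC hx.
have hsub : [set p in Q | a p != Some x] \subset ~: C :|: (byz E :\ ldr 1).
  apply/subsetP=> p; rewrite !inE => /andP[hQ ha].
  case hpC: (p \in C) => //=; apply/andP; split.
    by apply: contraNneq hlQ => <-.
  apply: contraNT ha => hp; apply/eqP; exact: hx.
have := subset_leq_card hsub.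
have := (leq_card_setU (~: C) (byz E :\ ldr 1)).1.
have := cardsC C; rewrite card_ord.
have := cardsD1 (ldr 1) (byz E); rewrite hl add1n.
move: hC byz_le t_gt0 le_tf n_ge.
move: #|[set p in Q | _]| #|~: C :|: _| #|_ :\ _| #|~: C| #|C| #|byz E|.
by lia.
Qed.

(** Strong induction on [v]: every lock in a view from [u] up to, but excluding, [v] is on [x]. The
    votes justifying [y] therefore only need to show a certificate of view at least [u]; if they
    show none, the choice was fast and the values acknowledged in view 1 are counted. *)
Lemma chosen_safe u x v p y : chosen u x -> u < v -> correct E p ->
  acked p v y -> y = x.
Proof.
move=> hch; elim/ltn_ind: v p y => v IH p y huv hp.
have hu0 : 0 < u := locked_gt0 (chosen_locked hch).
have hlocked u' z : locked u' z -> u <= u' -> u' < v -> z = x.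
  move=> hl; rewrite leq_eqVlt => /orP[/eqP hu|hu] hv.
    by apply: locked_inj hl _; rewrite -hu; exact: chosen_locked.
  by have [q hq hz] := locked_acked hl; exact: IH hz.
case=> i /(acks_origin hp) [j [[_ _ hv _ hacc] _]].
move: hacc; rewrite /acceptable hv ifF; last by apply/eqP; lia.
move=> [Q [a [c [hr [hQ hcert hsel]]]]].
have hvote q : q \in Q -> correct E q ->
    exists j, [/\ actor E j = q, ev E j = NewView v, view (sta q j) < v,
    a q = acks (sta q j) 1 & omap fst (c q) = omap fst (cert (sta q j))].
  move=> hq hcq; apply: (rcvd_vote hp hcq hr); right; right.
  by apply/signature_in_bundle; left.
(* Even a Byzantine voter cannot invent a certificate: its correct signers did acknowledge the
   value. *)
have hclocked q u' z A : q \in Q -> c q = Some (u', z, A) -> u' < v /\ locked u' z.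
  move=> hq hc; have [h1 h2] := hcert _ _ _ _ hq hc; split => //.
  exists A; split=> // q' hq' hcq'.
  have [|k _ hk] := rcvd_ack (u := u') (x := z) hp hcq' hr; last by exists k.
  right; right; apply/signature_in_bundle; right; exists q => //.
  right; right; rewrite hc /=; right; apply/signature_in_bundle; by left.
have hmax : (exists q u' z A, [/\ q \in Q, c q = Some (u', z, A) & u <= u']) ->
    y = x.
  case=> q0 [u0 [z0 [A0 [hq0 hc0 hu0']]]].
  case: hsel => [[q [u' [A [hq hc hm]]]]|[hnone _]]; last by rewrite hnone in hc0.
  have [hu'v hl] := hclocked _ _ _ _ hq hc.
  apply: hlocked hl _ hu'v; exact: leq_trans hu0' (hm _ _ _ _ hq0 hc0).
case: hch => [[C [hC hcom]]|[hu1 [C [hC hack]]]].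
  have [|q [hqC hqQ hcq]] := @quorum_meet C Q.
    by have := quorum_gt; have := quorum_le; lia.
  have [k [B hk]] := hcom _ hqC hcq.
  have [k' [ha he _ _ hcq']] := hvote _ hqQ hcq.
  have [u' [z [A [hs hu']]]] := cert_before_view hcq ha he huv hk.
  apply: hmax; move: hcq'; rewrite hs.
  case E': (c q) => [[[u'' z'] A']|] //= [hu'' _].
  by exists q, u'', z', A'; split=> //; rewrite hu''.
subst u.
have hav q : q \in Q -> q \in C -> correct E q -> a q = Some x.
  move=> hqQ hqC hcq; have [k hk] := hack _ hqC hcq.
  have [k' [ha he _ -> _]] := hvote _ hqQ hcq.
  exact: acks_before_view ha he huv hk.
(* Locked views are positive, so any certificate at all has view at least [u = 1]. *)
have [hc|/forallNP hnc] := pselect (exists q, q \in Q /\ c q <> None).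
  apply: hmax; case: hc => q [hq]; case E': (c q) => [[[u' z] A]|] // _.
  exists q, u', z, A; split => //.
  by have [_ /locked_gt0] := hclocked _ _ _ _ hq E'.
case: hsel => [[q [u' [A [hq hc _]]]]|[_ hsel]].
  by case: (hnc q); split => //; rewrite hc.
(* If the votes agree, one correct vote from [C] fixes their common value as [x]. *)
case: hsel => [hall|[hlQ [q [q' [z [z' [hq hq' hz hz' hzz']]]]] hsup]].
  have [|q [hqC hqQ hcq]] := @quorum_meet C Q; first by lia.
  by apply/esym/(hall _ _ hqQ); apply: hav.
(* A correct leader signs no value but its input, whereas two conflicting signed values are
   present. *)
have hl : ~~ correct E (ldr 1).
  apply/negP => hcl; case/eqP: hzz'.
  have hval q0 z0 : q0 \in Q -> a q0 = Some z0 -> z0 = input E (ldr 1).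
    move=> hq0 hz0; apply: (rcvd_value hp hcl hr); right; right.
    apply/signature_in_bundle; right; exists q0 => //.
    by right; left; rewrite hz0; left.
  by rewrite (hval _ _ hq hz) (hval _ _ hq' hz').
have hD := fast_chosen_dissent hl hlQ hC hav.
have hsum : support Q a x + #|[set p in Q | a p != Some x]| = #|Q|.
  rewrite /support -cardsUI -[RHS]addn0; congr (_ + _).
    by apply: eq_card => q0; rewrite !inE -andb_orr orbN andbT.
  by apply: eq_card0 => q0; rewrite !inE; case: eqP; rewrite ?andbF.
(* At most [f + t - 1] votes dissent from [x], while [Q] has at least [2 * f + 2 * t - 1] members;
   so [x] has support [f + t]. Any other value with that support would have too many dissenters
   behind it. *)
case: hsup => [hy|/(_ x)]; last by move: hsum hD hQ n_ge le_tf t_gt0; lia.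
apply: contrapT => hyx; move: hD; rewrite ltnNge; apply/negP; rewrite negbK.
apply: leq_trans hy (subset_leq_card _); apply/subsetP => q0.
rewrite !inE => /andP[-> /eqP ->] /=; apply/eqP => -[]; exact: hyx.
Qed.

(** * From decisions to consistency and extended validity *)

Lemma decides_chosen i k p x : correct E p -> decides_at E i k p x ->
  exists u, chosen u x.
Proof.
move=> hp [ha]; rewrite (acts_stp hp ha) => /stp_decide [_ hd _ _].
case: hd; rewrite -staE // => -[].
  move=> u [C [hC h]]; exists u; left; exists C; split=> // q hq hcq.
  have [r [k' [_ hs]]] := rcvd_sent hp (h _ hq).
  have [har hout] := sends_atP hcq hs.
  case: (stp_sent hout) => //.
  by move=> y A; rewrite -staE // => -[-> ->] hy; exists r.+1, A.
move=> C [hC h]; exists 1; right; split=> //; exists C; split => // q hq hcq.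
have [|j _ hj] := rcvd_ack (u := 1) (x := x) hp hcq (h _ hq); first by left.
by exists j.
Qed.

Lemma chosen_inj u v x y : chosen u x -> chosen v y -> x = y.
Proof.
wlog huv : u v x y / u <= v => [hw hx hy|hx hy].
  by case/orP: (leq_total u v) => h; [apply: hw h _ _|apply/esym; apply: hw h _ _].
move: huv; rewrite leq_eqVlt => /orP[/eqP huv|huv].
  rewrite huv in hx; exact: locked_inj (chosen_locked hx) (chosen_locked hy).
have [q hq hz] := locked_acked (chosen_locked hy).
by apply/esym; exact: chosen_safe hx huv hq hz.
Qed.

Lemma execution_consistency : consistency E.
Proof.
move=> p q i k x j l y hp hq /(decides_chosen hp) [u hx] /(decides_chosen hq) [v hy].
exact: chosen_inj hx hy.
Qed.

Lemma execution_decides_once : decides_once E.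
Proof.
move=> p i k x i' k' x' hp [ha hk] [ha' hk'].
move: hk hk'; rewrite (acts_stp hp ha) (acts_stp hp ha').
case/stp_decide=> -> _ hd1 hd2 /stp_decide [-> _ hd1' hd2'].
move: hd2 hd2'; rewrite -!staE // => hd2 hd2'; split=> //.
case: (ltngtP i i') => // h.
  by rewrite (decd_sta_mono h hd2) in hd1'.
by rewrite (decd_sta_mono h hd2') in hd1.
Qed.

(** An acknowledged value is traced back in time: to the signed input of the first leader, to the
    input of a later proposer, or through a certificate to an older acknowledgement. *)
Lemma execution_extended_validity : extended_validity E.
Proof.
move=> hall p i k x.
have hacked : forall i p u x, acks (sta p i) u = Some x -> exists q, x = input E q.
  elim/ltn_ind=> {p x}i' IH p u x /(acks_origin (hall p)).
  case=> j [[hji _ hv _ hacc] _].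
  move: hacc; rewrite /acceptable; case: eqP => _.
    move=> hr; exists (ldr 1).
    by apply: (rcvd_value (hall p) (hall _) hr); left.
  move=> [Q [a [c [hr _]]]].
  have [r [k' [hrj hs]]] := rcvd_sent (hall p) hr.
  have [har hout] := sends_atP (hall _) hs.
  case: (stp_sent hout) => //.
  move=> y Q' a' c' [_ -> _] _; rewrite -staE // => hrv.
  rewrite inp_sta => -[->|[q [hq hy]]] hj; first by eexists.
  case: hy => [hy|[u' [A hy]]].
    exists (ldr 1); apply: (rcvd_value (hall _) (hall _) (hrv _ hq)).
    by right; right; left; rewrite hy; left.
  have [_ /(_ _ _ _ _ hq hy) [_ hA] _] := hj.
  (* A quorum is nonempty, so the certificate has a signer to whom the induction hypothesis
     applies. *)
  have /set0Pn [q' hq'] : A != set0 by rewrite -card_gt0; apply: leq_trans hA.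
  have [|k'' hk'' hk] := rcvd_ack (u := u') (x := y) (hall _) (hall q') (hrv _ hq).
    right; right; right; rewrite hy /=; right.
    by apply/signature_in_bundle; left.
  by apply: (IH _ _ _ _ _ hk); lia.
case/(decides_chosen (hall p))=> u /chosen_locked /locked_acked [q _ [j hj]].
exact: hacked hj.
Qed.

(** * Liveness and speed *)

(** A leader holding [n - f] valid votes is never stuck. Conflicting values with the first leader
    still in [Q] are excluded by assumption, and [x0] serves whenever the votes leave the choice
    free. *)
Lemma justified_exists v (Q : {set 'I_n}) (a : 'I_n -> option V)
    (c : 'I_n -> option cert_data) x0 :
  n - f <= #|Q| ->
  (forall p u y A, p \in Q -> c p = Some (u, y, A) -> u < v /\ quorum <= #|A|) ->
  (ldr 1 \in Q -> forall p q y z, p \in Q -> q \in Q ->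
     a p = Some y -> a q = Some z -> y = z) ->
  exists x, justified v x Q a c /\
    (x = x0 \/ exists p, p \in Q /\
       (a p = Some x \/ exists u A, c p = Some (u, x, A))).
Proof.
move=> hQ hc ha; rewrite /justified.
have [[p0 hp0]|/forallNP hnc] := pselect (exists p, (p \in Q) && isSome (c p)).
  (* The default 0 is harmless: the maximum runs over voters with a certificate. *)
  pose g p := if c p is Some (u, _, _) then u else 0.
  have [p /andP[hp]] := @arg_maxnP _ p0 (fun p => (p \in Q) && isSome (c p)) g hp0.
  case E': (c p) => [[[u x] A]|] // _ hmax.
  exists x; split; last by right; exists p; split=> //; right; exists u, A.
  split=> //; left; exists p, u, A; split=> // p' u' y A' hp' hcp'.
  have := hmax p'; rewrite hp' hcp' /g hcp' E' => h; exact: h.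
have hnone p : p \in Q -> c p = None.
  by move=> hp; case E': (c p) => //; case: (hnc p); rewrite hp E'.
have [[p0 [y0 [hp0 hy0]]]|/forallNP hna] :=
    pselect (exists p y, p \in Q /\ a p = Some y); last first.
  exists x0; split; last by left.
  split=> //; right; split=> //; left=> p y hp hy; case: (hna p).
  by exists y.
have [hall|hdis] := pselect (forall p y, p \in Q -> a p = Some y -> y = y0).
  exists y0; split; last by right; exists p0; split=> //; left.
  by split=> //; right; split=> //; left.
have hl : ldr 1 \notin Q.
  apply/negP => hl; apply: hdis => p y hp hy; exact: (ha hl p p0).
have hev : exists p p' y z, [/\ p \in Q, p' \in Q, a p = Some y, a p' = Some z
    & y != z].
  apply: contrapT => hn; apply: hdis => p y hp hy; apply: contrapT => hyy.
  by apply: hn; exists p, p0, y, y0; split=> //; apply/eqP.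
have [[x hx]|/forallNP hns] := pselect (exists x, f + t <= support Q a x).
  exists x; split; first by split=> //; right; split=> //; right; split=> //; left.
  have /set0Pn [p] : [set p in Q | a p == Some x] != set0.
    by rewrite -card_gt0; apply: leq_trans hx; rewrite addn_gt0 t_gt0 orbT.
  by rewrite inE => /andP[hp /eqP hap]; right; exists p; split=> //; left.
exists x0; split; last by left.
split=> //; right; split=> //; right; split=> //; right => y.
by rewrite ltnNge; apply/negP/hns.
Qed.

(** * Real time, configurations and views *)

Lemma time_le i j : i <= j -> (time E i <= time E j)%R.
Proof.
move=> /subnKC <-; elim: (j - i) => [|k IH]; first by rewrite addn0.
by rewrite addnS; apply: le_trans IH _; case: (exec_time hE).
Qed.

(** Turns a point in time into the configuration [m] reached after all steps up to and including
    [tau]; it exists because time is unbounded. *)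
Lemma horizon (tau : R) : exists m, forall j, (j < m) = (time E j <= tau)%R.
Proof.
have hex : exists m, (tau < time E m)%R by case: (exec_time hE).
exists (ex_minn hex) => j; case: ex_minnP => m hm hmin.
apply/idP/idP => [hj|]; first by rewrite leNgt; apply: contraL hj => /hmin; rewrite -leqNgt.
rewrite ltnNge => hj; apply/negP => /time_le hmj.
by have := lt_le_trans hm (le_trans hmj hj); rewrite ltxx.
Qed.

Lemma view_staE p i : correct E p -> view (sta p i) = view_at E p i.
Proof.
move=> hp; elim: i => [//|i IH]; rewrite staS /=.
case: eqP => [ha|_]; last by rewrite IH; case: (ev E i).
rewrite -/(stp p (sta p i) (ev E i)) view_stp IH; case hev: (ev E i) => [|? ?|w|] //=.
apply/maxn_idPr/ltnW; case: (exec_views hE) => h _ _.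
by rewrite -ha; apply: h => //; rewrite ha.
Qed.

Lemma view_sta_const p i m v : i <= m -> view (sta p i) = v ->
  (forall j w, i <= j -> j < m -> actor E j = p -> ev E j <> NewView w) ->
  view (sta p m) = v.
Proof.
move=> him hv; elim: m him => [|m IH] him h.
  by move: him hv; rewrite leqn0 => /eqP ->.
move: him; rewrite leq_eqVlt => /orP[/eqP <- //|him].
have IH' : view (sta p m) = v by apply: IH => // j w h1 h2; apply: h => //; exact: ltnW.
rewrite staS; case: eqP => // ha; rewrite view_stp IH'.
by case hev: (ev E m) => [|? ?|w|] //; case: (h m w).
Qed.

Lemma view_origin p i v : correct E p -> 1 < v -> view (sta p i) = v ->
  exists j, [/\ actor E j = p, ev E j = NewView v, view (sta p j) < v,
    view (sta p j.+1) = v & j < i].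
Proof.
move=> hp hv; elim: i => [h|i IH h]; first by move: hv; rewrite -h.
have [hi|hi] := eqVneq (view (sta p i)) v.
  have [j [h1 h2 h3 h4 h5]] := IH hi.
  by exists j; split=> //; exact: ltnW.
exists i; move: (h); rewrite staS; case: eqP => [ha|_]; last first.
  by move=> hi'; rewrite hi' eqxx in hi.
rewrite view_stp; case hev: (ev E i) => [|? ?|w|]; try by move=> hi'; rewrite hi' eqxx in hi.
rewrite /maxn; case: ltnP => [hlt hw|_ hi']; last by rewrite hi' eqxx in hi.
by subst w; split.
Qed.

Lemma settled_sta p j m : actor E j = p -> j < m -> settled p (sta p m).
Proof.
move=> ha hj; apply: (@sta_mono (settled p) p j.+1) => //.
  by move=> s e _; apply: settled_stp.
by rewrite staE //; apply: settled_stp.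
Qed.

(** The start at time 0 guarantees that [p] has already taken a step. *)
Lemma settled_horizon p m (tau : R) : correct E p -> (0 <= tau)%R ->
  (forall j, (j < m) = (time E j <= tau)%R) -> settled p (sta p m).
Proof.
move=> hp ht hm; have [j [ha _ h0 _]] := exec_start hE hp.
by apply: (settled_sta ha); rewrite hm h0.
Qed.

Lemma delivery p q j k m b (tau : R) : correct E p -> correct E q ->
  sends_at E j k p q b -> (gst E <= time E j)%R -> (time E j <= tau)%R ->
  (forall i, (i < m) = (time E i <= tau + Delta)%R) -> rcvd (sta q m) p b.
Proof.
move=> hp hq hs hg ht hm; have [_ h] := exec_synchrony hE.
have [r [hr _ htr]] := h _ _ _ _ _ hp hq hs hg.
by apply: (receives_rcvd hr); rewrite hm; apply: le_trans htr _; rewrite lerD2r.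
Qed.

Lemma correct_card k : #|byz E| <= k -> n - k <= #|[set p | correct E p]|.
Proof.
have -> : [set p | correct E p] = ~: byz E by apply/setP=> p; rewrite !inE.
have := cardsC (byz E); rewrite card_ord.
by move: #|byz E| #|~: byz E| => b c; lia.
Qed.

(** The round common to both paths: a settled process that finds [x] acceptable must have
    acknowledged something in view [v], which can only be [x]. *)
Lemma ack_round v x m m' (tau : R) : (0 <= tau)%R ->
  (forall j, (j < m) = (time E j <= tau)%R) ->
  (forall j, (j < m') = (time E j <= tau + Delta)%R) ->
  (forall p, correct E p -> view (sta p m) = v /\ acceptable (sta p m) x) ->
  (forall p y, correct E p -> acked p v y -> y = x) ->
  (forall p j, correct E p -> actor E j = p -> view (sta p j.+1) = v ->
     gst E <= time E j)%R ->
  forall p q, correct E p -> correct E q -> rcvd (sta p m') q (ack_msg q v x).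
Proof.
move=> ht hm hm' hacc hinj hgst p q hp hq.
have [hv hx] := hacc _ hq.
have [_ hset _ _] := settled_horizon hq ht hm.
case hy: (acks (sta q m) v) => [y|]; last by case: (hset x); split; rewrite ?hv.
have hyx : y = x by apply: (hinj q) => //; exists m.
subst y; have [j [[hj ha hvj _ _] hs]] := acks_origin hq hy.
have [k hk] := hs p.
apply: (delivery hq hp hk) hm'; first exact: hgst hvj.
by rewrite -hm.
Qed.

Lemma acceptable_first x p i : correct E p -> view (sta p i) = 1 ->
  acceptable (sta p i) x -> correct E (ldr 1) -> x = input E (ldr 1).
Proof.
move=> hp hv; rewrite /acceptable hv eqxx => hr hl.
by apply: (rcvd_value hp hl hr); left.
Qed.

Lemma elected_view i v l m p (tau : R) : correct E l -> elected_at E i v l ->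
  (gst E <= config_time E i)%R -> correct E p ->
  (config_time E i <= tau)%R -> (tau < config_time E i + 5%:R * Delta)%R ->
  (forall j, (j < m) = (time E j <= tau)%R) ->
  view (sta p m) = v.
Proof.
move=> hl hel hg hp h1 h2 hm; have [_ hall _] := hel.
have him : i <= m by case: i {hel hall} h1 h2 hg => // i h1 _ _; rewrite hm.
apply: (view_sta_const him); first by rewrite view_staE // hall.
move=> j w hij hjm ha hev; have [_ _ h] := exec_views hE.
have := h _ _ _ hl hel hg j w hij; rewrite ha => /(_ hp hev).
by move: hjm; rewrite hm; lra.
Qed.

(** The second of two elections after GST is taken: everybody was still in the smaller view [v0]
    after GST, so that all steps in view [v], votes included, come after GST. *)
Lemma late_election : exists i v l, [/\ correct E l, elected_at E i v l,
  (gst E <= config_time E i)%R, 1 < v &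
  forall p j, correct E p -> actor E j = p -> view (sta p j.+1) = v ->
    (gst E <= time E j)%R].
Proof.
have [_ _ /(_ (gst E)) [N hN]] := exec_time hE.
have [_ hel _] := exec_views hE.
have [i0 [v0 [l0 [hi0 _ [_ hall0 _]]]]] := hel N.
have [i [v [l [hi hl h]]]] := hel i0.+1.
exists i, v, l; case: (h) => _ hall hnot.
case: i hi hall hnot h => // i hi hall hnot h.
have hlt : v0 < v.
  have hle p : correct E p -> v0 <= view (sta p i) <= v.
    move=> hp; rewrite -{1}(hall0 _ hp) -(hall _ hp) -!view_staE //.
    by rewrite !view_sta_le.
  rewrite ltn_neqAle; apply/andP; split; last first.
    by have /andP[] := hle _ hl; apply: leq_trans.
  (* With [v0 = v] all views would equal [v] one step before the second election, which would then
     not be new. *)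
  apply/eqP=> hv; apply: hnot => p hp; rewrite -view_staE //.
  by have := hle _ hp; rewrite hv => h'; apply/eqP; rewrite eqn_leq andbC.
have hgst j : i0 <= j -> (gst E <= time E j)%R.
  move=> hj; apply: ltW; apply: lt_le_trans hN _; apply: time_le.
  exact: leq_trans hi0 hj.
split=> //; first exact: hgst.
  apply: leq_ltn_trans hlt; rewrite -(hall0 _ hl) -view_staE //.
  by case: (inv_sta l i0).
move=> p j hp ha hv; apply: hgst; rewrite leqNgt; apply/negP => hj.
have := view_sta_le p hj; rewrite hv (view_staE _ hp) hall0 // => h'.
by move: hlt; rewrite ltnNge h'.
Qed.

Lemma leader_proposes l m v (tau : R) : correct E l -> l = ldr v -> 1 < v ->
  (0 <= tau)%R -> (forall j, (j < m) = (time E j <= tau)%R) ->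
  view (sta l m) = v ->
  (forall p, correct E p -> exists j,
    [/\ actor E j = p, ev E j = NewView v, view (sta p j) < v &
    rcvd (sta l m) p
      (Sign p (vote_body v (acks (sta p j) 1) (cert (sta p j))))]) ->
  exists x, props (sta l m) v = Some x.
Proof.
move=> hl hlv hv ht hm hview hvotes.
case hy: (props (sta l m) v) => [x|]; first by exists x.
(* [jj p] is the voting step of a correct [p]; for the others it is a dummy. *)
have /choice [jj hjj] : forall p, exists j, correct E p ->
    view (sta p j) < v /\ rcvd (sta l m) p
      (Sign p (vote_body v (acks (sta p j) 1) (cert (sta p j)))).
  move=> p; case hp: (correct E p); last by exists 0.
  by have [j [_ _ h1 h2]] := hvotes _ hp; exists j.
have [hset _ _ _] := settled_horizon hl ht hm.
have [|||x [hj hx]] := @justified_exists v [set p | correct E p]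
    (fun p => acks (sta p (jj p)) 1) (fun p => cert (sta p (jj p))) (inp (sta l m)).
- exact: correct_card.
- move=> p u y A; rewrite inE => /hjj [hlt _] hc.
  have [_ _ /(_ _ _ _ hc) [_ h2 h3 _]] := inv_sta p (jj p).
  by split => //; exact: leq_ltn_trans hlt.
- rewrite inE => hl1 p q y z; rewrite !inE => hp hq hyp hzq.
  have hval r w : correct E r -> acks (sta r (jj r)) 1 = Some w ->
      w = input E (ldr 1).
    move=> hr hw; have [_ /(_ _ hw) hrw _] := inv_sta r (jj r).
    by apply: (rcvd_value hr hl1 hrw); left.
  by rewrite (hval _ _ hp hyp) (hval _ _ hq hzq).
case: (hset (x, [set p | correct E p], fun p => acks (sta p (jj p)) 1,
  fun p => cert (sta p (jj p)))).
split=> //; rewrite ?hview //.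
by move=> p; rewrite inE => /hjj [].
Qed.

Hypothesis Delta_gt0 : (0 < Delta)%R.

Lemma config_time_ge0 i : (0 <= config_time E i)%R.
Proof. by case: i => //= i; case: (exec_time hE). Qed.

(** Since [props] holds one value per view, all acknowledgements under a correct leader agree. *)
Lemma acked_proposal p l v y : correct E p -> correct E l -> l = ldr v ->
  1 < v -> acked p v y -> exists i, props (sta l i) v = Some y.
Proof.
move=> hp hl hlv hv [i /(acks_origin hp) [j [[_ _ hvj _ hacc] _]]].
move: hacc; rewrite /acceptable hvj ifF; last by apply/eqP; lia.
rewrite -hlv => -[Q [a [c [hr _]]]].
have [r [k [_ hs]]] := rcvd_sent hp hr.
have [ha hout] := sends_atP hl hs.
case: (stp_sent hout) => //.
move=> x Q' a' c'; rewrite -staE // => -[hview <- _] h _ _ _.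
by exists r.+1; rewrite hview.
Qed.

(** Four rounds fit into the [5 * Delta] of a stable view: votes, proposal, acknowledgements and
    commits have arrived by [m1], [m2], [m3] and [m4]. *)
Lemma execution_liveness : liveness E.
Proof.
have hD := Delta_gt0.
have [i [v [l [hl hel hg hv hgst]]]] := late_election.
have [hlead hall _] := hel; have hlv := leaderE hlead.
have [T hT] : exists T, T = config_time E i by exists (config_time E i).
have hT0 : (0 <= T)%R by rewrite hT config_time_ge0.
have [m1 hm1] := horizon (T + Delta)%R.
have [m2 hm2] := horizon (T + Delta + Delta)%R.
have [m3 hm3] := horizon (T + Delta + Delta + Delta)%R.
have [m4 hm4] := horizon (T + Delta + Delta + Delta + Delta)%R.
have hview p m (tau : R) : correct E p -> (T <= tau)%R ->
    (tau < T + 5%:R * Delta)%R ->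
    (forall j, (j < m) = (time E j <= tau)%R) -> view (sta p m) = v.
  by rewrite hT; exact: elected_view hl hel hg.
(* All correct processes are in view [v] at configuration [i], so their votes were sent by time
   [T]. *)
have hi_le j : j < i -> (time E j <= T)%R.
  rewrite hT; case: (i) => // i'; rewrite ltnS; exact: time_le.
have [x hx] : exists x, props (sta l m1) v = Some x.
  have hT1 : (0 <= T + Delta)%R by lra.
  apply: (leader_proposes hl hlv hv hT1 hm1).
    by apply: (hview _ _ _ _ _ _ hm1) => //; lra.
  move=> p hp; have hvi : view (sta p i) = v by rewrite view_staE // hall.
  have [j [ha he hlt hvj hji]] := view_origin hp hv hvi.
  exists j; split=> //.
  have [k hk] := emits_sends_at hp ha (emits_vote p he hlt).
  rewrite -hlv in hk; apply: (delivery hp hl hk _ _ hm1); first exact: hgst hvj.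
  exact: hi_le.
have hinj p y : correct E p -> acked p v y -> y = x.
  move=> hp /(acked_proposal hp hl hlv hv) [k hk].
  exact: props_sta_inj hk hx.
have hacc p : correct E p -> view (sta p m2) = v /\ acceptable (sta p m2) x.
  move=> hp; have hv2 : view (sta p m2) = v.
    by apply: (hview _ _ _ _ _ _ hm2) => //; lra.
  split=> //; rewrite /acceptable hv2 ifF; last by apply/eqP; lia.
  have [j [[hj ha hvj _ _] [Q [a [c [_ hjust _ hs]]]]]] := props_origin hl hx.
  exists Q, a, c; split=> //; rewrite -hlv; have [k hk] := hs p.
  apply: (delivery hl hp hk _ _ hm2); first exact: hgst hvj.
  by rewrite -hm1.
have hack := ack_round _ hm2 hm3 hacc hinj hgst.
have {}hack : forall p q, correct E p -> correct E q ->
    rcvd (sta p m3) q (ack_msg q v x) by apply: hack; lra.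
have hcom p q : correct E p -> correct E q ->
    rcvd (sta p m4) q (commit_msg v x).
  move=> hp hq; have hv3 : view (sta q m3) = v.
    by apply: (hview _ _ _ _ _ _ hm3) => //; lra.
  have [y [B hB]] : exists y B, cert (sta q m3) = Some (v, y, B).
    have [|_ _ hset _] := settled_horizon hq _ hm3; first by lra.
    apply: contrapT => hn; apply: (hset (x, [set p | correct E p])).
    split; rewrite /= ?hv3.
    - by move=> y B h; apply: hn; exists y, B.
    - exact: leq_trans quorum_le (correct_card byz_le).
    - by move=> p'; rewrite inE; apply: hack.
  have hyx : y = x.
    have [|q' hq' hy] := @locked_acked v y; last exact: hinj hy.
    by apply: (committed_locked hq); exists m3, B.
  subst y; have [j [[hj ha hvj _] hs]] := cert_origin hq hB.
  have [k hk] := hs p.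
  apply: (delivery hq hp hk _ _ hm4); first exact: hgst hvj.
  by rewrite -hm3.
move=> p hp; suff hd : decd (sta p m4).
  by have [j [k [y [_ hy]]]] := decd_origin hp hd; exists j, k, y.
have [|_ _ _ hset] := settled_horizon hp _ hm4; first by lra.
apply: contrapT => /negP /negPf hn; apply: (hset x); split=> //; left.
exists v, [set q | correct E q]; split.
  exact: leq_trans quorum_le (correct_card byz_le).
by move=> q; rewrite inE; apply: hcom.
Qed.

(** Two rounds: the signed input arrives by [Delta], and the acknowledgements of the at least
    [n - t] correct processes by [2 * Delta]. *)
Lemma execution_fast : correct E (ldr 1) -> #|byz E| <= t -> gst E = 0%R ->
  forall p, correct E p ->
  exists i k x, decides_at E i k p x /\ (time E i <= 2%:R * Delta)%R.
Proof.
have hD := Delta_gt0; move=> hl hbt hgst.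
(* All views are initially 1, so the first leader counts as elected at configuration 0, and view 1
   is stable for [5 * Delta]. *)
have hel : elected_at E 0 1 (ldr 1) by split=> //; exact: leader_ldr.
have hg : (gst E <= config_time E 0)%R by rewrite hgst.
have hview p m (tau : R) : correct E p -> (0 <= tau)%R ->
    (tau < 0 + 5%:R * Delta)%R ->
    (forall j, (j < m) = (time E j <= tau)%R) -> view (sta p m) = 1.
  exact: elected_view hl hel hg.
have hgst' j : (gst E <= time E j)%R by rewrite hgst; case: (exec_time hE).
have [m1 hm1] := horizon Delta.
have [m2 hm2] := horizon (Delta + Delta)%R.
have hinj p y : correct E p -> acked p 1 y -> y = input E (ldr 1).
  move=> hp [i /(acks_origin hp) [j [[_ _ hv _ hacc] _]]].
  exact: acceptable_first hp hv hacc hl.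
have hacc p : correct E p ->
    view (sta p m1) = 1 /\ acceptable (sta p m1) (input E (ldr 1)).
  move=> hp; have hv1 : view (sta p m1) = 1.
    by apply: (hview _ _ _ _ _ _ hm1) => //; lra.
  split=> //; rewrite /acceptable hv1 eqxx.
  have [j [ha he h0 _]] := exec_start hE hl.
  have [k hk] := emits_sends_at hl ha (emits_first (sta (ldr 1) j) he erefl p).
  rewrite inp_sta in hk.
  apply: (delivery (tau := 0%R) hl hp hk) => //; first by rewrite h0.
  by rewrite add0r.
have hack : forall p q, correct E p -> correct E q ->
    rcvd (sta p m2) q (ack_msg q 1 (input E (ldr 1))).
  by apply: (ack_round _ hm1 hm2 hacc hinj) => //; exact: ltW.
move=> p hp; suff hd : decd (sta p m2).
  have [j [k [y [hj hy]]]] := decd_origin hp hd; exists j, k, y; split=> //.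
  by move: hj; rewrite hm2; lra.
have [|_ _ _ hset] := settled_horizon hp _ hm2; first by lra.
apply: contrapT => /negP /negPf hn; apply: (hset (input E (ldr 1))); split=> //.
right; exists [set q | correct E q]; split; first exact: correct_card.
by move=> q; rewrite inE; apply: hack.
Qed.

End Execution.

End Protocol.

(** * Assembly of the properties *)

Lemma fast_protocol_correct (R : realType) (n : nat) (V : eqType) (f t : nat)
    (Delta : R) (n_gt0 : 0 < n) : (0 < Delta)%R -> 0 < t -> t <= f ->
  3 * f + 2 * t - 1 <= n ->
  fast_byzantine_consensus Delta f t (fast_protocol R V f t n_gt0).
Proof.
move=> hD ht htf hn; split; first exact: fast_protocol_respects_keys.
  move=> E hE hb; split.
  - exact: execution_decides_once hE.
  - exact: execution_liveness hE ht htf hn hb hD.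
  - exact: execution_consistency hE ht htf hn hb.
  - exact: execution_extended_validity hE ht htf hn hb.
exists (ldr n_gt0 1); split; first exact: leader_ldr.
move=> E hE hl hb hg; apply: (execution_fast hE ht htf hn _ hD hl hb hg).
exact: leq_trans hb htf.
Qed.

Local Open Scope ring_scope.

Theorem mainTheorem1 (R : realType) (V : eqType) (Delta : R)
  (Delta_gt0 : 0 < Delta) :
  (forall f t n : nat, (1 <= t)%N -> (t <= f)%N -> (3 * f + 2 * t - 1 <= n)%N ->
     exists P : protocol R n V, fast_byzantine_consensus Delta f t P) /\
  (forall f n : nat, (1 <= f)%N -> (5 * f - 1 <= n)%N ->
     exists P : protocol R n V, fast_byzantine_consensus Delta f f P).
Proof.
have h f t n : (1 <= t)%N -> (t <= f)%N -> (3 * f + 2 * t - 1 <= n)%N ->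
    exists P : protocol R n V, fast_byzantine_consensus Delta f t P.
  move=> ht htf hn; have n_gt0 : (0 < n)%N by lia.
  by exists (fast_protocol R V f t n_gt0); exact: fast_protocol_correct.
split=> // f n hf hn; apply: h => //; lia.
Qed.
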